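(* Let $X\subseteq\{0,1\}^n$ be a lattice family given by a partial order $D$ on $[n]$, i.e. $X=\{x\in\{0,1\}^n\mid x_i\ge x_j\text{ for }(i,j)\in D\}$. Let $f:X\to\mathbb{R}$ be a disjunctive submodular function with representation $f(x)=\min_{k\in[K]}f_k(x)$ for $x\in X$, where each $f_k:X\to\mathbb{R}$ is submodular. Let $\bar F_k:\{0,1\}^{n+1}\to\mathbb{R}$, $k\in[K]$, be the extensions of the lifts of $f_k$ defined in the context, and define $\bar F(t,x):=\min_{k\in[K]}\bar F_k(t,x)$ for $(t,x)\in\{0,1\}^{n+1}$. Then each $\bar F_k$ is submodular on $\{0,1\}^{n+1}$, and $$\operatorname{conv}(f)(x)=\operatorname{sconv}(\bar F)(1,x)\qquad\text{for all }x\in\operatorname{conv}(X).$$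
   Context: $[n]=\{1,\dots,n\}$; $\vee,\wedge$ are componentwise max and min. A lattice family is a subset of $\{0,1\}^n$ closed under $\vee,\wedge$; $g$ on a lattice family is submodular if $g(x)+g(y)\ge g(x\vee y)+g(x\wedge y)$ for all $x,y$. A function $f:X\to\mathbb{R}$ on a lattice family $X$ is disjunctive submodular if $X=\bigcup_k X_k$ is a finite union of lattice families $X_k\subseteq X$ such that $f$ is submodular on each $X_k$. For $f:S\subseteq\mathbb{R}^n\to\mathbb{R}$, the convex envelope $\operatorname{conv}(f)$ is the largest convex function on $\operatorname{conv}(S)$ that is $\le f$ on $S$. A function $p$ on a convex cone is sublinear if $p(rx)=rp(x)$ for $r\ge0$ and $p(x+y)\le p(x)+p(y)$. The sublinear envelope $\operatorname{sconv}(f):\operatorname{cone}(S)\to\mathbb{R}$ is the largest sublinear function on $\operatorname{cone}(S)$ (the convex conic hull of $S$) that is $\le f$ on $S$. Lift: $\mathcal{L}:=\{(0,\mathbf 0)\}\cup\{(1,x)\mid x\in X\}\subseteq\{0,1\}^{n+1}$, which equals $\{(t,x)\in\{0,1\}^{n+1}\mid t\ge x_i\ (i\in[n]),\ x_i\ge x_j\ ((i,j)\in D)\}$. For each $k$, $F_k:\mathcal{L}\to\mathbb{R}$ is given by $F_k(0,\mathbf 0)=0$ and $F_k(1,x)=f_k(x)$ for $x\in X$. Retraction: $\rho:\{0,1\}^{n+1}\to\mathcal{L}$ is $\rho(t,x)=(t',x')$ with $t'=\max\{t,x_1,\dots,x_n\}$ and $x'_i=\max_{j:(i,j)\in D}x_j$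 for $i\in[n]$. Extension: $\bar F_k(z):=F_k(\rho(z))+C\|z-\rho(z)\|_1$ for $z\in\{0,1\}^{n+1}$, where $C=(n+1)^2(F^U-F^L)$ and $F^L\le F_k(t,x)\le F^U$ for all $(t,x)\in\mathcal{L}$ and $k\in[K]$. *)

(* Defs.v *)
From HB Require Import structures.
From mathcomp Require Import all_boot all_order all_algebra.
From mathcomp Require Import all_classical all_reals.
From mathcomp Require Import convex.

Set Implicit Arguments.
Unset Strict Implicit.
Unset Printing Implicit Defensive.
Import Order.TTheory GRing.Theory Num.Theory.
Local Open Scope classical_set_scope.
Local Open Scope ring_scope.

(* A function f : S -> R with S a subset of R^m is represented by a total
   function 'rV[R]_m -> R together with the set S; every definition below only
   looks at the values of f on S. *)

Section Submodularity.
Context {R : realType} {m : nat}.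
Implicit Types (x y : 'rV[R]_m) (A X : set 'rV[R]_m) (f : 'rV[R]_m -> R).

Definition cube : set 'rV[R]_m := [set x | forall i, x 0 i = 0 \/ x 0 i = 1].

Definition joinv x y : 'rV[R]_m := map2_mx Num.max x y.
Definition meetv x y : 'rV[R]_m := map2_mx Num.min x y.

Definition lattice_family A :=
  A `<=` cube /\ forall x y, A x -> A y -> A (joinv x y) /\ A (meetv x y).

Definition submodular_on A f :=
  forall x y, A x -> A y -> f (joinv x y) + f (meetv x y) <= f x + f y.

Definition disjunctive_submodular X f :=
  exists (K : nat) (Xs : 'I_K -> set 'rV[R]_m),
    X = \bigcup_k Xs k /\
    forall k, lattice_family (Xs k) /\ submodular_on (Xs k) f.

Definition l1norm x : R := \sum_i `|x 0 i|.

End Submodularity.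

Arguments cube {R} m.

Section Envelopes.
Context {R : realType} {m : nat}.
Implicit Types (x y : 'rV[R]_m) (A S : set 'rV[R]_m).
Implicit Types (f g h p q : 'rV[R]_m -> R).

Definition convex_hull S : set 'rV[R]_m :=
  [set x | exists (N : nat) (w : 'I_N -> R) (s : 'I_N -> 'rV[R]_m),
    [/\ forall i, 0 <= w i, \sum_i w i = 1, forall i, S (s i) &
        x = \sum_i w i *: s i]].

(* The empty combination is allowed, so the cone always contains 0. *)
Definition conic_hull S : set 'rV[R]_m :=
  [set x | exists (N : nat) (w : 'I_N -> R) (s : 'I_N -> 'rV[R]_m),
    [/\ forall i, 0 <= w i, forall i, S (s i) & x = \sum_i w i *: s i]].

Definition sublinear_on A p :=
  (forall r x, 0 <= r -> A x -> p (r *: x) = r * p x) /\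
  (forall x y, A x -> A y -> p (x + y) <= p x + p y).

Definition convex_minorant S f h :=
  convex_function (convex_hull S) h /\ forall x, S x -> h x <= f x.

Definition sublinear_minorant S f q :=
  sublinear_on (conic_hull S) q /\ forall x, S x -> q x <= f x.

(* The envelopes are functions on the hulls: these predicates determine g and p
   on the hull (see the uniqueness lemmas) and leave them free elsewhere. *)
Definition is_convex_envelope S f g :=
  convex_minorant S f g /\
  forall h, convex_minorant S f h -> forall x, convex_hull S x -> h x <= g x.

Definition is_sublinear_envelope S f p :=
  sublinear_minorant S f p /\
  forall q, sublinear_minorant S f q -> forall x, conic_hull S x -> q x <= p x.

Lemma convex_envelope_unique S f g1 g2 :
  is_convex_envelope S f g1 -> is_convex_envelope S f g2 ->
  forall x, convex_hull S x -> g1 x = g2 x.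
Proof.
move=> [m1 L1] [m2 L2] x Sx; apply/eqP; rewrite eq_le.
by rewrite (L2 _ m1 _ Sx) (L1 _ m2 _ Sx).
Qed.

Lemma sublinear_envelope_unique S f p1 p2 :
  is_sublinear_envelope S f p1 -> is_sublinear_envelope S f p2 ->
  forall x, conic_hull S x -> p1 x = p2 x.
Proof.
move=> [m1 L1] [m2 L2] x Sx; apply/eqP; rewrite eq_le.
by rewrite (L2 _ m1 _ Sx) (L1 _ m2 _ Sx).
Qed.

End Envelopes.

Section LiftAndExtension.
Context {R : realType} {n : nat}.
Implicit Types (D : rel 'I_n) (x : 'rV[R]_n) (z : 'rV[R]_(1 + n)).
Implicit Types (X : set 'rV[R]_n) (g : 'rV[R]_n -> R) (t C : R).

Definition order_family D : set 'rV[R]_n :=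
  [set x | cube n x /\ forall i j, D i j -> x 0 j <= x 0 i].

(* The point (t, x) of R^(n+1); tcoord and xcoord are its two components. *)
Definition tx t x : 'rV[R]_(1 + n) := row_mx (const_mx t) x.
Definition tcoord z : R := lsubmx z 0 0.
Definition xcoord z : 'rV[R]_n := rsubmx z.

Definition lifted_family X : set 'rV[R]_(1 + n) := tx 0 0 |` (tx 1 @` X).

(* On lifted_family X, t = 0 forces x = 0 and t = 1 forces x in X; other points
   are never evaluated. *)
Definition lift_fun g z : R := if tcoord z == 0 then 0 else g (xcoord z).

(* The initial value 0 of the second maximum is harmless: entries are in {0,1}
   and D is reflexive. *)
Definition retract D z : 'rV[R]_(1 + n) :=
  tx (\big[Num.max/tcoord z]_(i < n) xcoord z 0 i)
     (\row_(i < n) \big[Num.max/0]_(j < n | D i j) xcoord z 0 j).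

Definition extension D C g z : R :=
  lift_fun g (retract D z) + C * l1norm (z - retract D z).

Lemma order_family_lattice D : lattice_family (order_family D).
Proof.
split=> [x []//|x y [cx Dx] [cy Dy]]; split; split=> [i|i j Dij]; rewrite !mxE.
- by case: (leP (x 0 i) (y 0 i)).
- by rewrite ge_max !le_max Dx//= Dy// orbT.
- by case: (leP (x 0 i) (y 0 i)).
- by rewrite le_min !ge_min Dx//= Dy// orbT.
Qed.

Lemma tcoord_tx t x : tcoord (tx t x) = t.
Proof. by rewrite /tcoord /tx row_mxKl mxE. Qed.

Lemma xcoord_tx t x : xcoord (tx t x) = x.
Proof. exact: row_mxKr. Qed.

Lemma tx_coord z : tx (tcoord z) (xcoord z) = z.
Proof.
rewrite /tx -[RHS]hsubmxK; congr row_mx.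
by apply/rowP => i; rewrite mxE (ord1 i).
Qed.

Lemma cube_tx t x : cube _ (tx t x) <-> (t = 0 \/ t = 1) /\ cube n x.
Proof.
split=> [c|[c0 cx] i].
  split=> [|i]; first by have := c (lshift n 0); rewrite row_mxEl mxE.
  by have := c (rshift 1 i); rewrite row_mxEr.
by case: (split_ordP i) => j ->; rewrite ?row_mxEl ?row_mxEr ?mxE.
Qed.

Lemma lifted_order_familyE D : reflexive D ->
  lifted_family (order_family D) =
  [set z | cube _ z /\ (forall i, xcoord z 0 i <= tcoord z) /\
           forall i j, D i j -> xcoord z 0 j <= xcoord z 0 i].
Proof.
move=> Dr; apply/seteqP; split=> z /=.
  case=> [->|[x [cx Dx] <-]]; rewrite cube_tx tcoord_tx xcoord_tx.
    by split; [split; [left|move=> i; rewrite mxE; left]|split=> *; rewrite !mxE].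
  split; first by split=> //; right.
  by split=> // i; case: (cx i) => ->.
rewrite -(tx_coord z) cube_tx !tcoord_tx !xcoord_tx.
case=> -[[->|->] cx] [lx Dx]; [left|right]; last by exists (xcoord z).
congr tx; apply/rowP => i; rewrite [RHS]mxE.
by have := lx i; case: (cx i) => -> //; rewrite ler10.
Qed.

Lemma lift_fun_tx0 g : lift_fun g (tx 0 0) = 0.
Proof. by rewrite /lift_fun tcoord_tx eqxx. Qed.

Lemma lift_fun_tx1 g x : lift_fun g (tx 1 x) = g x.
Proof. by rewrite /lift_fun tcoord_tx xcoord_tx oner_eq0. Qed.

Lemma retract_lifted D z : reflexive D -> transitive D -> cube _ z ->
  lifted_family (order_family D) (retract D z).
Proof.
move=> Dr Dt; rewrite -{1}(tx_coord z) cube_tx => -[ct cx].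
have cmax (P : pred 'I_n) a : a = 0 \/ a = 1 ->
    \big[Num.max/a]_(j < n | P j) xcoord z 0 j = 0 \/
    \big[Num.max/a]_(j < n | P j) xcoord z 0 j = 1.
  move=> ca; by elim/big_ind: _ => // u v; case: (leP u v).
rewrite lifted_order_familyE//; split; [|split].
- by apply/cube_tx; split=> [|i]; rewrite ?mxE; apply: cmax => //; left.
- move=> i; rewrite tcoord_tx xcoord_tx mxE.
  have t0 : 0 <= tcoord z by case: ct => ->.
  apply: bigmax_le => [|j _]; last exact: le_bigmax.
  by apply: le_trans t0 _; apply: bigmax_ge_id.
- move=> i j Dij; rewrite xcoord_tx !mxE.
  apply: bigmax_le => [|k Djk]; first exact: bigmax_ge_id.
  by apply: le_bigmax_cond; apply: Dt Dij Djk.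
Qed.

End LiftAndExtension.

(* The index set [K] is taken nonempty, as 'I_K.+1, so that the minimum makes
   sense; starting the iteration at h ord0 x does not change it. *)
Definition min_fun {R : realType} {m K : nat} (h : 'I_K.+1 -> 'rV[R]_m -> R)
  (x : 'rV[R]_m) : R := \big[Num.min/h ord0 x]_(k < K.+1) h k x.

(* Main.v *)
Require Import Defs.
From mathcomp Require Import all_boot all_order all_algebra.
From mathcomp Require Import all_classical all_reals.
From mathcomp Require Import convex interval_inference ring lra.
(* Repeated so that set0, subsetP, ... mean finite sets again. *)
From mathcomp Require Import fintype finset.
Set Implicit Arguments.
Unset Strict Implicit.
Unset Printing Implicit Defensive.
Import Order.TTheory GRing.Theory Num.Theory.
Local Open Scope ring_scope.

(** Points of the cube are indicators of finite sets of coordinates.  Adding to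
    the order [D] a greatest coordinate for [t], with [E i j] meaning that
    coordinate [i] dominates coordinate [j], the lifted family becomes the
    family of [E]-closed sets and the retraction becomes the closure
    ([retract_indic]); so the extension is [G (cl A) + C * #|cl A :\: A|],
    where [G] is the lift ([extension_indic]).

    Submodularity ([set_extension_submod]).  Closure preserves unions, and
    [cl (A :&: B)] is contained in [cl A :&: cl B].  If the two are equal,
    submodularity of [G] on closed sets suffices.  If they differ, the penalty
    terms gain at least [C], and [G] varies by at most [FU - FL <= C].

    Envelopes.  The sublinear envelope at [y >= 0] is the infimum of the costs
    [\sum_A w A * Fbar (indic A)] over the nonnegative weights [w] with
    [\sum_A w A *: indic A = y] ([cube_sconvP]).  Call it [p]; it remains to
    see that [x |-> p (1, x)] is the convex envelope of [f].  It is convex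
    because [p] is sublinear, and it is below [f] because [Fbar] equals the lift
    on closed sets.  That it is above every convex minorant follows by Jensen's
    inequality from the exactness of the penalty ([repair]): when [y] satisfies
    the inequalities [y_j <= y_i] for [E i j], any decomposition of [y] can be
    replaced by one that uses closed sets only and costs no more.

    For the exactness, replace each set [A] by its closure.  The total then
    exceeds [y] by a vector [dl >= 0], and the penalty paid for it is
    [C * \sum_i dl i].  Since [y] lies in the cone generated by closed sets, one
    can release from the decomposition a part of total mass at most
    [#|T| * \sum_i dl i] whose total, minus [dl], still lies in that cone
    ([exists_released_mass]).  Decomposing that difference along its level sets
    ([layer_cake]) yields closed sets of no larger mass.  Every unit of released
    mass raises the cost by at most [FU - FL], and the penalty pays for that
    because [C >= #|T| * (FU - FL)].  This argument concerns arbitrary functions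
    [G] on closed sets, so it applies to the minimum of the [fk] directly. *)

(** * Closed sets of a preorder *)

Section Closure.
Context {T : finType} (E : rel T).
Implicit Types A B : {set T}.

Definition eclosed A := [forall i, forall j, E i j ==> (j \in A) ==> (i \in A)].
Definition eclosure A := [set i | [exists j in A, E i j]].

Lemma eclosedP A :
  reflect (forall i j, E i j -> j \in A -> i \in A) (eclosed A).
Proof.
apply: (iffP forallP) => [h i j Eij|h i].
  by move=> jA; have /forallP/(_ j) := h i; rewrite Eij jA.
by apply/forallP => j; apply/implyP => Eij; apply/implyP; apply: h.
Qed.

Lemma eclosureP A i : reflect (exists2 j, j \in A & E i j) (i \in eclosure A).
Proof. by rewrite inE; apply: (iffP exists_inP). Qed.

Lemma eclosure0 : eclosure set0 = set0.
Proof. by apply/setP => i; rewrite [RHS]inE; apply/eclosureP => -[j]; rewrite inE. Qed.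

Lemma eclosureS A B : A \subset B -> eclosure A \subset eclosure B.
Proof.
move=> /subsetP AB; apply/subsetP => i /eclosureP[j jA Eij].
by apply/eclosureP; exists j => //; apply: AB.
Qed.

Lemma eclosureU A B : eclosure (A :|: B) = eclosure A :|: eclosure B.
Proof.
apply/eqP; rewrite eqEsubset subUset !eclosureS ?subsetUl ?subsetUr // !andbT.
apply/subsetP => i /eclosureP[j]; rewrite !inE => /orP[] jA Eij; apply/orP.
  by left; apply/exists_inP; exists j.
by right; apply/exists_inP; exists j.
Qed.

Lemma eclosedI A B : eclosed A -> eclosed B -> eclosed (A :&: B).
Proof.
move=> /eclosedP cA /eclosedP cB; apply/eclosedP => i j Eij.
by rewrite !inE => /andP[/(cA _ _ Eij)-> /(cB _ _ Eij)->].
Qed.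

Lemma eclosure_closed A : transitive E -> eclosed (eclosure A).
Proof.
move=> Et; apply/eclosedP => i j Eij /eclosureP[k kA Ejk].
by apply/eclosureP; exists k => //; apply: Et Eij Ejk.
Qed.

Lemma sub_eclosure A : reflexive E -> A \subset eclosure A.
Proof. by move=> Er; apply/subsetP => i iA; apply/eclosureP; exists i. Qed.

Lemma eclosed_id A : reflexive E -> eclosed A -> eclosure A = A.
Proof.
move=> Er /eclosedP cA; apply/eqP; rewrite eqEsubset sub_eclosure // andbT.
by apply/subsetP => i /eclosureP[j jA Eij]; apply: cA Eij jA.
Qed.

End Closure.

(** * Submodularity of the penalised extension *)

Section SetExtension.
Context {R : realType} {T : finType} (E : rel T).
Hypotheses (Erefl : reflexive E) (Etrans : transitive E).
Variables (G : {set T} -> R) (FL FU : R).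
Hypothesis (G_bounds : forall A, eclosed E A -> FL <= G A <= FU).
Local Notation cl := (eclosure E).

Definition set_extension (C : R) (A : {set T}) :=
  G (cl A) + C * #|cl A :\: A|%:R.

(** The cardinalities of [A] and [B] cancel in the penalties, so the difference
    of the two sides is governed by whether [cl (A :&: B)] fills
    [cl A :&: cl B].  If it does not, one missing element is worth [C]. *)
Lemma set_extension_submod (C : R) A B : FU - FL <= C ->
  (forall A B, eclosed E A -> eclosed E B ->
     G (A :|: B) + G (A :&: B) <= G A + G B) ->
  set_extension C (A :|: B) + set_extension C (A :&: B) <=
  set_extension C A + set_extension C B.
Proof.
move=> leC Gsub; rewrite /set_extension eclosureU.
have clA := eclosure_closed A Etrans; have clB := eclosure_closed B Etrans.
have clI := eclosure_closed (A :&: B) Etrans.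
have := Gsub _ _ clA clB.
set P := cl A in clA *; set Q := cl B in clB *; set S := cl (A :&: B) in clI *.
have SPQ : S \subset P :&: Q.
  by rewrite subsetI /S /P /Q !eclosureS ?subsetIl ?subsetIr.
have cardD (U V : {set T}) : V \subset U -> #|U :\: V|%:R = #|U|%:R - #|V|%:R :> R.
  by move=> VU; rewrite cardsD (setIidPr VU) natrB // subset_leq_card.
have [AP BQ IS] : [/\ A \subset P, B \subset Q & A :&: B \subset S].
  by split; apply: sub_eclosure.
rewrite !cardD // ?setUSS //.
have cUI (U V : {set T}) : #|U :|: V|%:R + #|U :&: V|%:R = #|U|%:R + #|V|%:R :> R.
  by rewrite -!natrD cardsUI.
have := cUI A B; have := cUI P Q.
have [->|/eqP SnPQ] := eqVneq S (P :&: Q).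
  by move=> /(congr1 ( *%R C)) + /(congr1 ( *%R C)); rewrite !mulrBr !mulrDr; lra.
have lt1 : #|S|%:R + 1 <= #|P :&: Q|%:R :> R.
  rewrite natr1 ler_nat; apply: proper_card.
  by rewrite properEneq SPQ andbT; apply/eqP.
have /andP[l1 u1] := G_bounds clI; have /andP[l2 u2] := G_bounds (eclosedI clA clB).
have C0 : 0 <= C by lra.
have := ler_wpM2l C0 lt1.
by move=> + /(congr1 ( *%R C)) + /(congr1 ( *%R C)); rewrite !mulrBr !mulrDr; lra.
Qed.

End SetExtension.

(** * Decompositions into closed sets *)

Section Masses.
Context {R : realType} {T : finType}.
Implicit Types (w u v : {set T} -> R).

(** The coordinates of [\sum_A w A *: indic A]. *)
Definition cover_mass w i := \sum_A w A * (i \in A)%:R.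

Lemma cover_massD w u i :
  cover_mass (fun A => w A + u A) i = cover_mass w i + cover_mass u i.
Proof. by rewrite -big_split; apply: eq_bigr => A _; rewrite mulrDl. Qed.

Lemma push_sum (h : {set T} -> {set T}) w (F : {set T} -> R) :
  \sum_B (\sum_(A | h A == B) w A) * F B = \sum_A w A * F (h A).
Proof.
rewrite [RHS](partition_big h xpredT) //=; apply: eq_bigr => B _.
by rewrite mulr_suml; apply: eq_bigr => A /eqP->.
Qed.

End Masses.

Section LayerCake.
Context {R : realType} {T : finType} (E : rel T).

(** A vector of the cone of [E] is decomposed along its level sets: subtract the
    smallest positive value on the support, which is closed, and recurse on the
    smaller support. *)
Lemma layer_cake (r : T -> R) :
    (forall i, 0 <= r i) -> (forall i j, E i j -> r j <= r i) ->
  exists u : {set T} -> R,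
    [/\ forall A, 0 <= u A,
        forall A, u A != 0 -> eclosed E A /\ A != set0 &
        forall i, cover_mass u i = r i].
Proof.
have [N] := ubnP #|[set i | 0 < r i]|.
elim: N r => // N IH r leN r0 rE.
have [S0|/set0Pn[i0 i0S]] := eqVneq [set i | 0 < r i] set0.
  exists (fun=> 0); split=> // [A|i]; first by rewrite eqxx.
  rewrite /cover_mass big1 => [|A _]; last by rewrite mul0r.
  have : i \notin [set i | 0 < r i] by rewrite S0 inE.
  by rewrite inE lt_neqAle r0 andbT negbK => /eqP.
set S := [set i | 0 < r i] in leN i0S *.
have [k kS kmin] : exists2 k, k \in S & forall i, i \in S -> r k <= r i.
  by case: (arg_minP r i0S) => k kS kmin; exists k.
have rk0 : 0 < r k by rewrite inE in kS.
pose r' i := r i - r k * (i \in S)%:R.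
have r'0 i : 0 <= r' i.
  rewrite /r' subr_ge0; case: (boolP (i \in S)) => iS; first by rewrite mulr1 kmin.
  by rewrite mulr0.
have [||u [u0 uS um]] := IH r' _ r'0.
- rewrite ltnS in leN; apply: leq_trans leN; apply: proper_card.
  apply/properP; split.
    apply/subsetP => i; rewrite !inE => h; apply: lt_le_trans h _.
    by rewrite gerBl mulr_ge0 // ltW.
  by exists k; rewrite // inE /r' kS mulr1 subrr ltxx.
- move=> i j Eij; rewrite /r'.
  have := rE _ _ Eij; rewrite /S !inE => rji.
  case: (ltP 0 (r j)) => rj.
    by rewrite (lt_le_trans rj rji) lerD2r.
  rewrite mulr0 subr0 (le_trans rj) // -/(r' i); have := r'0 i.
  by rewrite /r' inE.
exists (fun A => u A + r k * (A == S)%:R); split=> [A|A|i].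
- by rewrite addr_ge0 // mulr_ge0 // ltW.
- have [->|nAS] := eqVneq A S; last by rewrite mulr0 addr0; apply: uS.
  move=> _; split; last by apply/set0Pn; exists i0.
  apply/eclosedP => i j /rE rji; rewrite !inE => rj; exact: lt_le_trans rj rji.
- rewrite cover_massD um /cover_mass (bigD1 S) //= eqxx mulr1 big1 => [|A /negPf->].
    by rewrite addr0 subrK.
  by rewrite mulr0 mul0r.
Qed.

End LayerCake.

Section Repair.
Context {R : realType} {T : finType} (E : rel T).
Hypotheses (Erefl : reflexive E) (Etrans : transitive E).
Local Notation cl := (eclosure E).
Implicit Types (A : {set T}) (w v u : {set T} -> R).

Definition closure_mass w i := \sum_A w A * (i \in cl A)%:R.

Definition overshoot w i := \sum_A w A * (i \in cl A :\: A)%:R.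

Lemma overshootE w i : overshoot w i = closure_mass w i - cover_mass w i.
Proof.
rewrite -sumrB; apply: eq_bigr => A _; rewrite -mulrBr in_setD; congr (_ * _).
have /subsetP/(_ i) := sub_eclosure A Erefl.
by case: (i \in A) => /= [->//|_]; rewrite ?subrr ?subr0.
Qed.

Lemma overshoot_ge0 w i : (forall A, 0 <= w A) -> 0 <= overshoot w i.
Proof. by move=> w0; apply: sumr_ge0 => A _; rewrite mulr_ge0. Qed.

Lemma sum_overshoot w : \sum_i overshoot w i = \sum_A w A * #|cl A :\: A|%:R.
Proof.
rewrite exchange_big /=; apply: eq_bigr => A _.
rewrite -mulr_sumr -natr_sum; congr (_ * _%:R).
by rewrite -sum1_card [RHS]big_mkcond.
Qed.

Lemma closure_massB v i j : E i j ->
  closure_mass v i - closure_mass v j =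
  \sum_(A | (i \in cl A) && (j \notin cl A)) v A.
Proof.
move=> Eij; rewrite -sumrB [RHS]big_mkcond; apply: eq_bigr => A _ /=.
have /eclosedP/(_ i j Eij) := eclosure_closed A Etrans.
rewrite -mulrBr; case: (j \in cl A) => [->//|_]; first by rewrite subrr mulr0.
by rewrite andbT subr0; case: ifP; rewrite ?mulr1 ?mulr0.
Qed.

(** The released mass [v] must satisfy
    [overshoot w i - overshoot w j <= \sum_A v A], the sum being over the [A]
    whose closure contains [i] but not [j], for all [E i j], and
    [overshoot w i <= \sum_A v A] over the [A] whose closure contains [i].  By
    the inequalities on [cover_mass w], the whole of [w] satisfies all of these.
    So each requirement can be met by rescaling [w] on the sets it is about,
    with a mass of at most [overshoot w i]; the sum of these #|T|^2 measures,
    cut at [w], meets all the requirements. *)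
Lemma exists_released_mass w :
    (forall A, 0 <= w A) ->
    (forall i j, E i j -> cover_mass w j <= cover_mass w i) ->
  exists v,
    [/\ forall A, 0 <= v A <= w A,
        \sum_A v A <= #|T|%:R * \sum_i overshoot w i,
        forall i, overshoot w i <= closure_mass v i &
        forall i j, E i j ->
          closure_mass v j - overshoot w j <= closure_mass v i - overshoot w i].
Proof.
move=> w0 wE; pose dl := overshoot w.
have dl0 i : 0 <= dl i by apply: overshoot_ge0.
have y0 i : 0 <= cover_mass w i.
  by apply: sumr_ge0 => A _; rewrite mulr_ge0.
(* The pair (i, i) stands for the requirement that coordinate i stay
   nonnegative. *)
pose sep i j A := (i \in cl A) && ((j == i) || (j \notin cl A)).
pose W i j := \sum_(A | sep i j A) w A.
pose nu i j := if E i j then Num.max 0 (dl i - dl j *+ (j != i)) else 0.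
have sepE (u : {set T} -> R) i j : E i j -> \sum_(A | sep i j A) u A =
    closure_mass u i - closure_mass u j *+ (j != i).
  move=> Eij; have [->|nij] := eqVneq j i; last first.
    rewrite closure_massB //; apply: eq_bigl => A.
    by rewrite /sep (negPf nij).
  rewrite subr0 big_mkcond; apply: eq_bigr => A _.
  by rewrite /sep eqxx andbT; case: ifP; rewrite ?mulr1 ?mulr0.
have W0 i j : 0 <= W i j by apply: sumr_ge0.
have nu0 i j : 0 <= nu i j by rewrite /nu; case: ifP; rewrite ?le_max lexx.
have nuW i j : nu i j <= W i j.
  rewrite /nu; case: ifP => // Eij; rewrite ge_max W0 /W sepE //= /dl !overshootE.
  have := wE _ _ Eij; have := y0 i.
  by case: (j != i); rewrite ?mulr0n ?mulr1n; lra.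
have nu_le i j : nu i j <= dl i.
  rewrite /nu; case: ifP => // _; rewrite ge_max dl0 /=.
  by rewrite gerBl mulrn_wge0.
(* When W i j = 0, also nu i j = 0, and the quotient 0 / 0 = 0 is right. *)
pose vv i j A := if sep i j A then nu i j / W i j * w A else 0.
have vv_sum i j : \sum_A vv i j A = nu i j.
  rewrite /vv -big_mkcond /= -mulr_sumr -/(W i j).
  have [W00|Wn0] := eqVneq (W i j) 0; last by rewrite divfK.
  by rewrite W00 mulr0; apply/esym/eqP; rewrite eq_le nu0 andbT -W00.
have vv0 i j A : 0 <= vv i j A.
  by rewrite /vv; case: ifP => // _; rewrite mulr_ge0 // divr_ge0.
have vv_le i j A : vv i j A <= w A.
  rewrite /vv; case: ifP => // _; apply: ler_piMl => //.
  have := W0 i j; rewrite le_eqVlt => /predU1P[<-|Wp].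
    by rewrite invr0 mulr0.
  by rewrite ler_pdivrMr // mul1r.
pose v A := Num.min (w A) (\sum_i \sum_j vv i j A).
have vv_v i j A : vv i j A <= v A.
  rewrite /v le_min vv_le /= (bigD1 i) //= (bigD1 j) //= -addrA lerDl.
  by rewrite addr_ge0 ?sumr_ge0 // => k _; apply: sumr_ge0.
have v_sep i j : E i j -> dl i - dl j *+ (j != i) <= \sum_(A | sep i j A) v A.
  move=> Eij; apply: (@le_trans _ _ (nu i j)).
    by rewrite /nu Eij le_max lexx orbT.
  rewrite -vv_sum [leRHS]big_mkcond; apply: ler_sum => A _.
  by have := vv_v i j A; rewrite /vv; case: ifP.
exists v; split=> [A||i|i j Eij].
- rewrite /v ge_min lexx le_min w0 andbT /=.
  by apply: sumr_ge0 => i _; apply: sumr_ge0.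
- apply: (@le_trans _ _ (\sum_A \sum_i \sum_j vv i j A)).
    by apply: ler_sum => A _; rewrite /v ge_min lexx orbT.
  rewrite exchange_big /= mulr_sumr; apply: ler_sum => i _.
  rewrite exchange_big /= (eq_bigr (nu i)) => [|j _]; last exact: vv_sum.
  by rewrite mulr_natl -sumr_const; apply: ler_sum.
- by have := v_sep _ _ (Erefl i); rewrite sepE // eqxx !subr0.
- have [->//|nij] := eqVneq j i.
  by have := v_sep _ _ Eij; rewrite sepE // nij !mulr1n /dl; lra.
Qed.

Variable top : T.
Hypothesis (Etop : forall i, E top i).
Variables (G : {set T} -> R) (FL FU : R).
Hypothesis (G0 : G set0 = 0).
Hypothesis (G_bounds : forall A, eclosed E A -> FL <= G A <= FU).

(** Exactness of the penalty.  The repaired decomposition keeps [w - v] on the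
    closures and replaces the released mass [v] by the level sets of what it
    must still cover.  Nonempty closed sets contain [top], so the mass of these
    level sets is read off at [top] and does not exceed that of [v]. *)
Lemma repair (C : R) w :
    #|T|%:R * (FU - FL) <= C ->
    (forall A, 0 <= w A) ->
    (forall i j, E i j -> cover_mass w j <= cover_mass w i) ->
  exists u,
    [/\ forall A, 0 <= u A,
        forall A, u A != 0 -> eclosed E A,
        forall i, cover_mass u i = cover_mass w i &
        \sum_A u A * G A <= \sum_A w A * set_extension E G C A].
Proof.
move=> leC w0 wE.
have [v [vw v_sum v_ge vE]] := exists_released_mass w0 wE.
have v0 A : 0 <= v A by case/andP: (vw A).
have dl0 i : 0 <= overshoot w i by apply: overshoot_ge0.
pose r i := closure_mass v i - overshoot w i.
have r0 i : 0 <= r i by rewrite subr_ge0.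
have [u' [u'0 u'cl u'm]] := layer_cake r0 vE.
have u'_sum : \sum_A u' A <= \sum_A v A.
  have -> : \sum_A u' A = r top.
    rewrite -u'm; apply: eq_bigr => A _.
    have [->|/u'cl[/eclosedP cA /set0Pn[j jA]]] := eqVneq (u' A) 0.
      by rewrite mul0r.
    by rewrite (cA _ _ (Etop j) jA) mulr1.
  rewrite /r lerBlDr; apply: (@le_trans _ _ (\sum_A v A)); last by rewrite lerDl.
  by apply: ler_sum => A _; apply: ler_piMr => //; rewrite lern1 leq_b1.
have cl0 : eclosed E set0 by apply/eclosedP => i j _; rewrite inE.
have /andP[FL0 FU0] := G_bounds cl0; rewrite G0 in FL0 FU0.
exists (fun B => (\sum_(A | cl A == B) (w A - v A)) + u' B); split=> [B|B|i|].
- rewrite addr_ge0 // sumr_ge0 // => A _; rewrite subr_ge0.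
  by case/andP: (vw A).
- have [->|/u'cl[]//] := eqVneq (u' B) 0; rewrite addr0.
  apply: contraNT => nB; apply/eqP; apply: big1 => A /eqP clAB.
  by case/negP: nB; rewrite -clAB eclosure_closed.
- rewrite cover_massD u'm /r overshootE /cover_mass push_sum /=.
  under eq_bigr do rewrite mulrBl.
  by rewrite sumrB /closure_mass; ring.
- under eq_bigr do rewrite mulrDl.
  rewrite big_split /= push_sum /=.
  under eq_bigr do rewrite mulrBl.
  rewrite sumrB.
  have -> : \sum_A w A * set_extension E G C A =
      \sum_A w A * G (cl A) + C * \sum_i overshoot w i.
    rewrite /set_extension; under eq_bigr do rewrite mulrDr mulrCA.
    by rewrite big_split /= -mulr_sumr sum_overshoot.
  have released : FL * \sum_A v A <= \sum_A v A * G (cl A).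
    rewrite mulr_sumr; apply: ler_sum => A _; rewrite mulrC ler_wpM2l //.
    by have /andP[] := G_bounds (eclosure_closed A Etrans).
  have added : \sum_A u' A * G A <= FU * \sum_A v A.
    apply: (@le_trans _ _ (FU * \sum_A u' A)); last by rewrite ler_wpM2l.
    rewrite mulr_sumr; apply: ler_sum => A _.
    have [->|/u'cl[cA _]] := eqVneq (u' A) 0; first by rewrite mul0r mulr0.
    by rewrite mulrC ler_wpM2r //; have /andP[] := G_bounds cA.
  have paid : (FU - FL) * \sum_A v A <= C * \sum_i overshoot w i.
    have D0 : 0 <= FU - FL by lra.
    apply: le_trans (ler_wpM2l D0 v_sum) _.
    by rewrite mulrA (mulrC (FU - FL)) ler_wpM2r // sumr_ge0.
  rewrite -!addrA lerD2l; move: released added paid; rewrite mulrBl; lra.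
Qed.

End Repair.

(** * Convex functions and Jensen's inequality *)

Section Hulls.
Context {R : realType} {m : nat}.
Implicit Types (S : set 'rV[R]_m) (x y : 'rV[R]_m) (f h : 'rV[R]_m -> R).

(** Convexity with real weights in place of the interval type [{i01 R}]. *)
Lemma convex_functionP S h :
  convex_function S h <->
  forall t x y, 0 <= t <= 1 -> S x -> S y ->
    h (t *: x + (1 - t) *: y) <= t * h x + (1 - t) * h y.
Proof.
split=> [cf t x y /andP[t0 t1] Sx Sy|cf t x y /set_mem Sx /set_mem Sy].
  exact: (cf (Itv01 t0 t1) x y (mem_set Sx) (mem_set Sy)).
by apply: cf => //; rewrite ge0 le1.
Qed.

Lemma subset_convex_hull S x : S x -> convex_hull S x.
Proof.
move=> Sx; exists 1%N, (fun=> 1), (fun=> x); split=> //.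
  by rewrite big_ord1.
by rewrite big_ord1 scale1r.
Qed.

Lemma jensen_ord S h N (w : 'I_N -> R) (s : 'I_N -> 'rV[R]_m) :
  convex_function (convex_hull S) h ->
  (forall i, 0 <= w i) -> \sum_i w i = 1 -> (forall i, S (s i)) ->
  h (\sum_i w i *: s i) <= \sum_i w i * h (s i).
Proof.
move=> /convex_functionP ch.
elim: N w s => [|N IH] w s w0 w1 sS.
  by move: w1; rewrite big_ord0 => /esym/eqP; rewrite oner_eq0.
rewrite !big_ord_recl in w1 *.
set W := \sum_(i < N) w (lift ord0 i) in w1 *.
have W0 : 0 <= W by apply: sumr_ge0.
have wE : w ord0 = 1 - W by lra.
have [W00|Wn0] := eqVneq W 0.
  have wt0 i : w (lift ord0 i) = 0.
    by apply: (psumr_eq0P (P := xpredT) _ W00) => // k _.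
  rewrite wE W00 subr0 !big1 => [|i _|i _]; rewrite ?wt0 ?mul0r ?scale0r //.
  by rewrite !addr0 scale1r mul1r.
pose w' i := w (lift ord0 i) / W.
have w'0 i : 0 <= w' i by rewrite divr_ge0.
have w'1 : \sum_i w' i = 1 by rewrite -mulr_suml divff.
have w'E i : w (lift ord0 i) = W * w' i by rewrite mulrC divfK.
under eq_bigr => i _ do rewrite w'E -scalerA.
under [X in _ <= _ + X]eq_bigr => i _ do rewrite w'E -mulrA.
rewrite -scaler_sumr -mulr_sumr wE addrC [X in _ <= X]addrC.
have le1 : 0 <= W <= 1 by rewrite W0 /=; have := w0 ord0; lra.
apply: le_trans (ch _ _ _ le1 _ _) _.
- by exists N, w', (fun i => s (lift ord0 i)).
- exact: subset_convex_hull.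
- by rewrite lerD2r ler_wpM2l // IH.
Qed.

Lemma jensen (I : finType) S h (w : I -> R) (s : I -> 'rV[R]_m) :
  convex_function (convex_hull S) h ->
  (forall i, 0 <= w i) -> \sum_i w i = 1 -> (forall i, w i != 0 -> S (s i)) ->
  h (\sum_i w i *: s i) <= \sum_i w i * h (s i).
Proof.
move=> ch w0 w1 sS.
(* The points of weight 0 may lie outside S: enumerate the other indices. *)
have supp (V : nmodType) (F : I -> V) : (forall i, w i = 0 -> F i = 0) ->
    \sum_i F i = \sum_(k < #|[pred i | w i != 0]|) F (enum_val k).
  move=> F0; rewrite -(big_enum_val (A := [pred i | w i != 0])) /= [RHS]big_mkcond /=.
  by apply: eq_bigr => i _; rewrite inE; case: eqP => // /F0.
rewrite !supp => [|i ->|i ->]; rewrite ?mul0r ?scale0r //.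
apply: jensen_ord => // [|i].
  by rewrite -(supp _ w).
by apply: sS; have := enum_valP i; rewrite inE.
Qed.

End Hulls.

(** * The sublinear envelope of a function on the cube *)

Section CubeEnvelope.
Context {R : realType} {m : nat}.
Implicit Types (A : {set 'I_m}) (x y : 'rV[R]_m) (w : {set 'I_m} -> R).

Definition indic A : 'rV[R]_m := \row_i (i \in A)%:R.

Lemma cube_indic A : cube m (indic A).
Proof. by move=> i; rewrite mxE; case: (i \in A); [right|left]. Qed.

Lemma cubeP x : cube m x -> exists A, x = indic A.
Proof.
move=> cx; exists [set i | x 0 i == 1]; apply/rowP => i; rewrite mxE inE.
by case: (cx i) => ->; rewrite ?eqxx // eq_sym oner_eq0.
Qed.

Lemma sum_indicE w i : (\sum_A w A *: indic A) 0 i = cover_mass w i.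
Proof. by rewrite summxE; apply: eq_bigr => A _; rewrite !mxE. Qed.

Lemma exists_cover_mass y : (forall i, 0 <= y 0 i) ->
  exists2 w, forall A, 0 <= w A & forall i, cover_mass w i = y 0 i.
Proof.
move=> y0; exists (fun A => \sum_(i | [set i] == A) y 0 i) => [A|i].
  exact: sumr_ge0.
pose h (j : 'I_m) := [set j].
rewrite /cover_mass.
transitivity (\sum_j y 0 j * (i \in [set j])%:R).
  rewrite [RHS](partition_big h xpredT) //=; apply: eq_bigr => A _.
  by rewrite mulr_suml; apply: eq_bigr => j /eqP <-.
rewrite (bigD1 i) //= inE eqxx mulr1 big1 ?addr0 // => j nji.
by rewrite inE eq_sym (negPf nji) mulr0.
Qed.

Lemma conic_hull_cubeP y : conic_hull (cube m) y <-> forall i, 0 <= y 0 i.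
Proof.
split=> [[N [w [s [w0 sC ->]]]] i|y0].
  rewrite summxE; apply: sumr_ge0 => k _; rewrite mxE mulr_ge0 //.
  by case: (sC k i) => ->.
have [w w0 wE] := exists_cover_mass y0.
exists #|{: {set 'I_m}}|, (fun k => w (enum_val k)), (fun k => indic (enum_val k)).
split=> // [k|]; first exact: cube_indic.
apply/rowP => i; rewrite -wE -sum_indicE; congr (fun_of_matrix _ 0 i).
exact: (big_enum_val (fun A => w A *: indic A)).
Qed.

Lemma sublinear_indic (q : 'rV[R]_m -> R) w :
  sublinear_on (conic_hull (cube m)) q -> (forall A, 0 <= w A) ->
  q (\sum_A w A *: indic A) <= \sum_A w A * q (indic A).
Proof.
move=> [qZ qD] w0.
suff [] : conic_hull (cube m) (\sum_A w A *: indic A) /\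
  q (\sum_A w A *: indic A) <= \sum_A w A * q (indic A) by [].
have ind0 A i : 0 <= (w A *: indic A) 0 i by rewrite !mxE mulr_ge0.
have indC A : conic_hull (cube m) (indic A).
  by apply/conic_hull_cubeP => i; rewrite mxE.
elim/big_rec2: _ => [|A c y _ [yC yc]].
  have C0 : conic_hull (cube m) (0 : 'rV[R]_m).
    by apply/conic_hull_cubeP => i; rewrite mxE.
  by split=> //; have := qZ 0 0 (lexx 0) C0; rewrite scale0r mul0r => ->.
have wA : conic_hull (cube m) (w A *: indic A) by apply/conic_hull_cubeP.
split.
  move/conic_hull_cubeP in yC; apply/conic_hull_cubeP => i.
  by rewrite mxE addr_ge0.
by apply: le_trans (qD _ _ wA yC) _; rewrite qZ // lerD2l.
Qed.

Variable phi : 'rV[R]_m -> R.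
Hypothesis phi0 : 0 <= phi 0.

Definition cost w := \sum_A w A * phi (indic A).

Definition decomposes w y := (forall A, 0 <= w A) /\ forall i, cover_mass w i = y 0 i.

Definition cube_sconv y : R :=
  inf (fun c => exists2 w, decomposes w y & c = cost w).

Lemma indic0 : indic set0 = 0.
Proof. by apply/rowP => i; rewrite !mxE inE. Qed.

(** Bounds the infimum from below: the empty set costs [phi 0 >= 0] and every
    other set has mass at most its contribution to [\sum_i y 0 i]. *)
Lemma cost_lbound w y : decomposes w y ->
  - (\sum_A `|phi (indic A)|) * \sum_i y 0 i <= cost w.
Proof.
move=> [w0 wE]; under [X in _ * X]eq_bigr do rewrite -wE.
rewrite /cover_mass exchange_big /= mulr_sumr; apply: ler_sum => A _.
rewrite -mulr_sumr mulrCA; apply: ler_wpM2l => //.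
have [->|/set0Pn[i iA]] := eqVneq A set0.
  by rewrite indic0 [X in _ * X]big1 ?mulr0 // => i _; rewrite inE.
have : `|phi (indic A)| <= \sum_A `|phi (indic A)|.
  by rewrite [leRHS](bigD1 A) //= lerDl sumr_ge0.
have : 1 <= \sum_i (i \in A)%:R :> R.
  by rewrite (bigD1 i) //= iA lerDl sumr_ge0.
set B := \sum_A `|_|; set n := \sum_i _%:R => n1 aB.
have := ler_norm (- phi (indic A)); rewrite normrN => ha.
have B0 : 0 <= B by apply: sumr_ge0.
have := ler_wpM2l B0 n1; rewrite mulr1 mulNr; lra.
Qed.

Lemma cube_sconv_le w y : decomposes w y -> cube_sconv y <= cost w.
Proof.
move=> dw; apply: ge_inf; last by exists w.
exists (- (\sum_A `|phi (indic A)|) * \sum_i y 0 i) => c [u du ->].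
exact: cost_lbound.
Qed.

Lemma le_cube_sconv y c : (forall i, 0 <= y 0 i) ->
  (forall w, decomposes w y -> c <= cost w) -> c <= cube_sconv y.
Proof.
move=> y0 cle; apply: lb_le_inf => [|_ [w dw ->]]; last exact: cle.
by have [w w0 wE] := exists_cover_mass y0; exists (cost w), w.
Qed.

Lemma decomposesZ r w y : 0 <= r -> decomposes w y ->
  decomposes (fun A => r * w A) (r *: y).
Proof.
move=> r0 [w0 wE]; split=> [A|i]; first exact: mulr_ge0.
by rewrite mxE -wE mulr_sumr; apply: eq_bigr => A _; rewrite mulrA.
Qed.

Lemma costZ r w : cost (fun A => r * w A) = r * cost w.
Proof. by rewrite mulr_sumr; apply: eq_bigr => A _; rewrite mulrA. Qed.

Lemma cube_sconvZ_le r y : 0 < r -> (forall i, 0 <= y 0 i) ->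
  cube_sconv (r *: y) <= r * cube_sconv y.
Proof.
move=> r0 y0; rewrite -ler_pdivrMl //; apply: le_cube_sconv => // w dw.
rewrite ler_pdivrMl // -costZ; apply: cube_sconv_le.
exact: decomposesZ (ltW r0) dw.
Qed.

Lemma cube_sconv0 : cube_sconv 0 = 0.
Proof.
have z0 i : 0 <= (0 : 'rV[R]_m) 0 i by rewrite mxE.
apply/eqP; rewrite eq_le; apply/andP; split.
  have <- : cost (fun=> 0) = 0 by rewrite /cost big1 // => A _; rewrite mul0r.
  apply: cube_sconv_le; split=> // i.
  by rewrite mxE /cover_mass big1 // => A _; rewrite mul0r.
apply: le_cube_sconv => // w [w0 wE]; apply: sumr_ge0 => A _.
have [->|/set0Pn[i iA]] := eqVneq A set0; first by rewrite indic0 mulr_ge0.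
have : cover_mass w i = 0 by rewrite wE mxE.
move=> /psumr_eq0P/(_ A isT); rewrite iA mulr1 => -> //; first by rewrite mul0r.
by move=> B _; rewrite mulr_ge0.
Qed.

Lemma cube_sconv_sublinear : sublinear_on (conic_hull (cube m)) cube_sconv.
Proof.
split=> [r y r0|x y] /conic_hull_cubeP.
  move=> y0; have [->|rn0] := eqVneq r 0.
    by rewrite scale0r mul0r cube_sconv0.
  have rp : 0 < r by rewrite lt_def rn0.
  apply/eqP; rewrite eq_le cube_sconvZ_le //= -ler_pdivlMl //.
  have ry0 i : 0 <= (r *: y) 0 i by rewrite mxE mulr_ge0.
  have := cube_sconvZ_le (r := r^-1) _ ry0.
  by rewrite scalerA mulVf // scale1r invr_gt0; apply.
move=> x0 /conic_hull_cubeP y0.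
rewrite -lerBlDr; apply: le_cube_sconv => // w [w0 wE].
rewrite lerBlDr -lerBlDl; apply: le_cube_sconv => // u [u0 uE].
rewrite lerBlDl.
have -> : cost w + cost u = cost (fun A => w A + u A).
  by rewrite -big_split; apply: eq_bigr => A _; rewrite mulrDl.
apply: cube_sconv_le; split=> [A|i]; first exact: addr_ge0.
by rewrite cover_massD wE uE mxE.
Qed.

(** A sublinear minorant of [phi] is below the cost of every decomposition by
    [sublinear_indic], which makes the infimum the largest one. *)
Lemma cube_sconvP : is_sublinear_envelope (cube m) phi cube_sconv.
Proof.
split; first split.
- exact: cube_sconv_sublinear.
- move=> x /cubeP[A ->].
  have <- : cost (fun B => (B == A)%:R) = phi (indic A).
    rewrite /cost (bigD1 A) //= eqxx mul1r big1 ?addr0 // => B /negPf->.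
    by rewrite mul0r.
  apply: cube_sconv_le; split=> // i; rewrite mxE /cover_mass.
  rewrite (bigD1 A) //= eqxx mul1r big1 ?addr0 // => B /negPf->.
  by rewrite mul0r.
- move=> q [qs qphi] y /conic_hull_cubeP y0.
  apply: le_cube_sconv => // w [w0 wE].
  have -> : y = \sum_A w A *: indic A by apply/rowP => i; rewrite sum_indicE wE.
  apply: le_trans (sublinear_indic qs w0) _; apply: ler_sum => A _.
  by rewrite ler_wpM2l // qphi //; apply: cube_indic.
Qed.

End CubeEnvelope.

(** * Minima of finitely many functions *)

Section MinFun.
Context {R : realType} {K : nat}.

Lemma min_funD (m m' : nat) (h : 'I_K.+1 -> 'rV[R]_m -> R)
    (h' : 'I_K.+1 -> 'rV[R]_m' -> R) x y c :
  (forall k, h' k y = h k x + c) -> min_fun h' y = min_fun h x + c.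
Proof.
move=> hE; rewrite /min_fun hE; under eq_bigr do rewrite hE.
have mD : {morph +%R^~ c : a b / Num.min a b} by move=> a b; rewrite addr_minl.
by rewrite (big_morph _ mD (erefl _)).
Qed.

Lemma min_fun_bounds (m : nat) (h : 'I_K.+1 -> 'rV[R]_m -> R) x L U :
  (forall k, L <= h k x <= U) -> L <= min_fun h x <= U.
Proof.
move=> hb; apply/andP; split.
  by apply: le_bigmin => [|k _]; case/andP: (hb ord0) => // *; case/andP: (hb k).
by apply: le_trans (bigmin_le_id _ _ _ _) _; case/andP: (hb ord0).
Qed.

End MinFun.

(** * The lift as the closed sets of a preorder *)

Section Bridge.
Context {R : realType} {n : nat} (D : rel 'I_n).
Hypotheses (Drefl : reflexive D) (Dtrans : transitive D).
Implicit Types (A B : {set 'I_(1 + n)}).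

Definition top : 'I_(1 + n) := lshift n ord0.

(** The order [D] with [top] added as a greatest coordinate, encoding
    [t >= x_i] along with [x_i >= x_j]. *)
Definition lift_order : rel 'I_(1 + n) := fun i j =>
  match split i, split j with
  | inl _, _ => true
  | inr i', inr j' => D i' j'
  | inr _, inl _ => false
  end.

Lemma lift_order_top j : lift_order top j.
Proof. by rewrite /lift_order /top (unsplitK (inl ord0)). Qed.

Lemma lift_orderE i j : lift_order (rshift 1 i) (rshift 1 j) = D i j.
Proof. by rewrite /lift_order !(unsplitK (inr _)). Qed.

Lemma lift_order_rtop i : lift_order (rshift 1 i) top = false.
Proof. by rewrite /lift_order /top (unsplitK (inr _)) (unsplitK (inl _)). Qed.

Lemma lift_order_refl : reflexive lift_order.
Proof. by move=> i; rewrite /lift_order; case: (split i). Qed.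

Lemma lift_order_trans : transitive lift_order.
Proof.
move=> j i k; rewrite /lift_order.
by case: (split i) (split j) (split k) => [?|i'] [?|j'] [?|k'] //; apply: Dtrans.
Qed.

Local Notation E := lift_order.

Lemma tcoord_indic A : tcoord (indic A : 'rV[R]__) = (top \in A)%:R.
Proof. by rewrite /tcoord !mxE. Qed.

Lemma xcoord_indic A i : xcoord (indic A : 'rV[R]__) 0 i = (rshift 1 i \in A)%:R.
Proof. by rewrite /xcoord !mxE. Qed.

Lemma eq_top_rshift i : i = top \/ exists i', i = rshift 1 i'.
Proof. by case: (split_ordP i) => j ->; [left; rewrite (ord1 j)|right; exists j]. Qed.

Lemma tx_top (t : R) (x : 'rV[R]_n) : tx t x 0 top = t.
Proof. by rewrite row_mxEl mxE. Qed.

Lemma tx_rshift (t : R) (x : 'rV[R]_n) j : tx t x 0 (rshift 1 j) = x 0 j.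
Proof. exact: row_mxEr. Qed.

(** Closedness at the pairs [(top, i)] says [x_i <= t], and at the others it is
    the order [D]. *)
Lemma eclosed_lifted A : eclosed E A <->
  lifted_family (order_family D) (indic A : 'rV[R]_(1 + n)).
Proof.
rewrite lifted_order_familyE //; split.
  move=> /eclosedP cA; split; first exact: cube_indic.
  have le i j : E i j -> (j \in A)%:R <= (i \in A)%:R :> R.
    by move=> /cA; case: (j \in A) => [->|]; rewrite ?ler0n.
  split=> [i|i j Dij]; rewrite ?tcoord_indic !xcoord_indic; apply: le.
    exact: lift_order_top.
  by rewrite lift_orderE.
move=> [_ [tA DA]]; apply/eclosedP => i j Eij jA.
have [ei|[i' ei]] := eq_top_rshift i; have [ej|[j' ej]] := eq_top_rshift j; subst.
- by [].
- have := tA j'; rewrite tcoord_indic xcoord_indic jA.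
  by case: (top \in A); rewrite // ler10.
- by rewrite lift_order_rtop in Eij.
- have := DA i' j'; rewrite -lift_orderE => /(_ Eij); rewrite !xcoord_indic jA.
  by case: (_ \in A); rewrite // ler10.
Qed.

(** Maxima of 0-1 values are disjunctions, so the retraction of an indicator is
    the indicator of a closure. *)
Lemma bigmax_nat_bool (I : finType) (P c : pred I) (b : bool) :
  \big[Num.max/b%:R]_(i | P i) (c i)%:R = (b || [exists i, P i && c i])%:R :> R.
Proof.
apply/eqP; rewrite eq_le; apply/andP; split.
  apply: bigmax_le => [|i Pi]; rewrite ler_nat; first by case: b.
  case ci: (c i) => //; suff -> : [exists i, P i && c i] by rewrite orbT.
  by apply/existsP; exists i; rewrite Pi.
case: b => /=; first exact: bigmax_ge_id.
case: existsP => [[i /andP[Pi ci]]|_]; last exact: bigmax_ge_id.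
by apply: le_trans (le_bigmax_cond _ (fun i => (c i)%:R) Pi); rewrite ci.
Qed.

Lemma retract_indic A :
  retract D (indic A : 'rV[R]_(1 + n)) = indic (eclosure E A).
Proof.
rewrite -[RHS]tx_coord; congr tx.
  rewrite !tcoord_indic; under eq_bigr do rewrite xcoord_indic.
  rewrite bigmax_nat_bool; congr (nat_of_bool _)%:R.
  apply/idP/eclosureP.
    case/orP => [tA|/existsP[i iA]]; first by exists top => //; apply: lift_order_top.
    by exists (rshift 1 i) => //; apply: lift_order_top.
  move=> [j jA _]; have [<-|[j' ej]] := eq_top_rshift j; first by rewrite jA.
  by apply/orP; right; apply/existsP; exists j'; rewrite -ej.
apply/rowP => i; rewrite xcoord_indic mxE.
under eq_bigr do rewrite xcoord_indic.
rewrite (bigmax_nat_bool _ _ false); congr (nat_of_bool _)%:R.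
apply/existsP/eclosureP.
  by move=> [j /andP[Dij jA]]; exists (rshift 1 j); rewrite ?lift_orderE.
move=> [j jA]; have [->|[j' ej]] := eq_top_rshift j.
  by rewrite lift_order_rtop.
by rewrite ej lift_orderE => Dij; exists j'; rewrite Dij -ej.
Qed.

Lemma extension_indic C g A :
  extension D C g (indic A : 'rV[R]_(1 + n)) =
  set_extension E (fun B => lift_fun g (indic B)) C A.
Proof.
rewrite /extension /set_extension retract_indic; congr (_ + C * _).
rewrite /l1norm -sum1_card natr_sum [RHS]big_mkcond /=; apply: eq_bigr => i _.
rewrite !mxE in_setD; have /subsetP/(_ i) := sub_eclosure A lift_order_refl.
case: (i \in A) => /= [->//|_]; first by rewrite subrr normr0.
by rewrite sub0r normrN; case: (i \in _); rewrite ?normr1 ?normr0.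
Qed.

Lemma joinv_indic A B : joinv (indic A) (indic B) = indic (A :|: B) :> 'rV[R]_(1 + n).
Proof.
apply/rowP => i; rewrite !mxE inE.
by case: (i \in A); case: (i \in B); rewrite /= ?maxxx // /Num.max ?ltr01 ?ltr10.
Qed.

Lemma meetv_indic A B : meetv (indic A) (indic B) = indic (A :&: B) :> 'rV[R]_(1 + n).
Proof.
apply/rowP => i; rewrite !mxE inE.
by case: (i \in A); case: (i \in B); rewrite /= ?minxx // /Num.min ?ltr01 ?ltr10.
Qed.

Lemma eclosed_notop A : eclosed E A -> top \notin A -> A = set0.
Proof.
move=> /eclosedP cA nt; apply/setP => i; rewrite [RHS]inE; apply: contraNF nt.
exact/cA/lift_order_top.
Qed.

Lemma indic_tx1 A : top \in A -> indic A = tx 1 (xcoord (indic A)) :> 'rV[R]_(1 + n).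
Proof. by move=> tA; rewrite -[LHS]tx_coord tcoord_indic tA. Qed.

Lemma lifted_tx1 (x : 'rV[R]_n) :
  lifted_family (order_family D) (tx 1 x) <-> order_family D x.
Proof.
split=> [[h|[y Xy h]]|Xx]; last by right; exists x.
  by have := congr1 tcoord h; rewrite !tcoord_tx => /eqP; rewrite oner_eq0.
by have := congr1 xcoord h; rewrite !xcoord_tx => <-.
Qed.

Lemma eclosed_order_family A : eclosed E A -> top \in A ->
  order_family D (xcoord (indic A : 'rV[R]_(1 + n))).
Proof. by move=> /eclosed_lifted cA tA; apply/lifted_tx1; rewrite -indic_tx1. Qed.

Lemma lift_fun_top (g : 'rV[R]_n -> R) A : top \in A ->
  lift_fun g (indic A) = g (xcoord (indic A)).
Proof. by move=> tA; rewrite [in LHS]indic_tx1 // lift_fun_tx1. Qed.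

Lemma lift_fun_submod (g : 'rV[R]_n -> R) A B :
  submodular_on (order_family D) g -> eclosed E A -> eclosed E B ->
  lift_fun g (indic (A :|: B)) + lift_fun g (indic (A :&: B)) <=
  lift_fun g (indic A) + lift_fun g (indic B).
Proof.
move=> gsub cA cB.
have [tA|/(eclosed_notop cA)->] := boolP (top \in A); last first.
  by rewrite set0U set0I addrC.
have [tB|/(eclosed_notop cB)->] := boolP (top \in B); last first.
  by rewrite setU0 setI0.
have := gsub _ _ (eclosed_order_family cA tA) (eclosed_order_family cB tB).
rewrite !lift_fun_top ?in_setU ?in_setI ?tA ?tB // -joinv_indic -meetv_indic.
by rewrite /xcoord /joinv /meetv !map2_rsubmx.
Qed.

Lemma extension_submod (C FL FU : R) (g : 'rV[R]_n -> R) :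
  submodular_on (order_family D) g ->
  (forall z, lifted_family (order_family D) z -> FL <= lift_fun g z <= FU) ->
  FU - FL <= C -> submodular_on (cube (1 + n)) (extension D C g).
Proof.
move=> gsub gb leC x y /cubeP[A ->] /cubeP[B ->].
rewrite joinv_indic meetv_indic !extension_indic.
apply: (set_extension_submod (G := fun S => lift_fun g (indic S)) lift_order_refl lift_order_trans
  _ _ _ leC).
  by move=> S /eclosed_lifted; apply: gb.
by move=> S S'; apply: lift_fun_submod.
Qed.

(** The inequalities [E] hold at the lifts of the generators and are linear;
    they are what lets [repair] act on a decomposition of [(1, x)]. *)
Lemma convex_hull_order (x : 'rV[R]_n) : convex_hull (order_family D) x ->
  forall i j, E i j -> tx 1 x 0 j <= tx 1 x 0 i.
Proof.
move=> [N [w [s [w0 w1 sX ->]]]].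
have txE : tx 1 (\sum_i w i *: s i) = \sum_i w i *: tx 1 (s i).
  apply/rowP => k; rewrite summxE; have [->|[j ->]] := eq_top_rshift k.
    by rewrite tx_top -[LHS]w1; apply: eq_bigr => i _; rewrite mxE tx_top mulr1.
  by rewrite tx_rshift summxE; apply: eq_bigr => i _; rewrite [RHS]mxE tx_rshift mxE.
move=> i j Eij; rewrite txE !summxE; apply: ler_sum => k _.
rewrite [leLHS]mxE [leRHS]mxE ler_wpM2l //.
have /lifted_tx1 : order_family D (s k) by [].
have [|A ->] := @cubeP R (1 + n) (tx 1 (s k)).
  by apply/cube_tx; split; [right|case: (sX k)].
move=> /eclosed_lifted/eclosedP cA; rewrite !mxE ler_nat.
by have := cA _ _ Eij; case: (j \in A) => // ->.
Qed.

Lemma convex_hull_tx1_ge0 (x : 'rV[R]_n) : convex_hull (order_family D) x ->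
  forall i, 0 <= tx 1 x 0 i.
Proof.
move=> [N [w [s [w0 w1 sX ->]]]] k; have [->|[j ->]] := eq_top_rshift k.
  by rewrite tx_top.
rewrite tx_rshift summxE; apply: sumr_ge0 => i _; rewrite mxE mulr_ge0 //.
by case: (sX i) => /(_ j)[]->.
Qed.

Lemma tx_comb (t : R) (x y : 'rV[R]_n) :
  tx 1 (t *: x + (1 - t) *: y) = t *: tx 1 x + (1 - t) *: tx 1 y.
Proof.
rewrite /tx !scale_row_mx add_row_mx; congr row_mx.
by apply/rowP => i; rewrite !mxE; ring.
Qed.

(** * Comparison of the two envelopes *)

Section Envelope.
Variables (K : nat) (f : 'rV[R]_n -> R) (fk : 'I_K.+1 -> 'rV[R]_n -> R).
Hypothesis f_min : forall x, order_family D x -> f x = min_fun fk x.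
Variables (FL FU C : R).
Hypothesis F_bounds : forall k z, lifted_family (order_family D) z ->
  FL <= lift_fun (fk k) z <= FU.
Hypothesis leC : n.+1%:R * (FU - FL) <= C.

Let G A := min_fun (fun k => lift_fun (fk k)) (indic A).
Let Fbar := min_fun (fun k => extension D C (fk k)).

Let G_bounds A : eclosed E A -> FL <= G A <= FU.
Proof. by move=> /eclosed_lifted cA; apply: min_fun_bounds => k; apply: F_bounds. Qed.

Let G0 : G set0 = 0.
Proof.
have /andP[] : 0 <= G set0 <= 0.
  apply: min_fun_bounds => k; rewrite /lift_fun tcoord_indic inE eqxx.
  by rewrite lexx.
by move=> a b; apply/eqP; rewrite eq_le a b.
Qed.

Let Fbar_indic A : Fbar (indic A) = set_extension E G C A.
Proof.
by apply: min_funD => k; rewrite extension_indic.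
Qed.

Let G_top A : eclosed E A -> top \in A -> G A = f (xcoord (indic A)).
Proof.
move=> cA tA; rewrite f_min; last exact: eclosed_order_family.
rewrite -[RHS]addr0; apply: min_funD => k.
by rewrite lift_fun_top // addr0.
Qed.

Lemma Fbar_lifted x : order_family D x -> Fbar (tx 1 x) = f x.
Proof.
move=> Xx; have [|A eA] := @cubeP R (1 + n) (tx 1 x).
  by apply/cube_tx; split; [right|case: Xx].
have cA : eclosed E A by apply/eclosed_lifted; rewrite -eA; apply/lifted_tx1.
have tA : top \in A.
  have := congr1 tcoord eA; rewrite tcoord_tx tcoord_indic.
  by case: (top \in A) => // /eqP; rewrite oner_eq0.
rewrite eA Fbar_indic /set_extension (eclosed_id lift_order_refl cA).
by rewrite setDv cards0 mulr0 addr0 G_top // -eA xcoord_tx.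
Qed.

(** Given a decomposition of [(1, x)], [repair] turns it into one over closed
    sets.  Those that contain [top] are points [(1, x')] with [x'] in the order
    family, and their weights sum to 1, so Jensen's inequality applies; the only
    other closed set is empty and costs nothing. *)
Lemma convex_minorant_le h x : convex_minorant (order_family D) f h ->
  convex_hull (order_family D) x -> h x <= cube_sconv Fbar (tx 1 x).
Proof.
move=> [ch hf] Xx; apply: le_cube_sconv => [|w [w0 wE]].
  exact: convex_hull_tx1_ge0.
have leC' : #|'I_(1 + n)|%:R * (FU - FL) <= C by rewrite card_ord.
have wE' i j : E i j -> cover_mass w j <= cover_mass w i.
  by move=> Eij; rewrite !wE; apply: convex_hull_order.
have [u [u0 ucl um ule]] :=
  repair lift_order_refl lift_order_trans lift_order_top G0 G_bounds leC' w0 wE'.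
apply: (@le_trans _ _ (\sum_A u A * G A)); last first.
  apply: le_trans ule _; apply: ler_sum => A _.
  by rewrite ler_wpM2l // Fbar_indic.
pose u' A := u A * (top \in A)%:R.
have u'cl A : u' A != 0 -> eclosed E A /\ top \in A.
  rewrite /u'; case: (top \in A); rewrite ?mulr0 ?eqxx // mulr1 => /ucl cA.
  by [].
have xE : x = \sum_A u' A *: xcoord (indic A).
  apply/rowP => i; rewrite -(xcoord_tx 1 x) /xcoord summxE mxE.
  rewrite -wE -um; apply: eq_bigr => A _; rewrite !mxE /u'.
  have [->|/ucl/eclosedP cA] := eqVneq (u A) 0; first by rewrite !mul0r.
  have := cA _ _ (lift_order_top (rshift 1 i)).
  by case: (rshift 1 i \in A) => [->//|_]; rewrite ?mulr1 ?mulr0.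
have u'1 : \sum_A u' A = 1.
  by rewrite -/(cover_mass u top) um wE tx_top.
rewrite xE; apply: le_trans (jensen ch _ u'1 _) _.
- by move=> A; rewrite mulr_ge0.
- by move=> A /u'cl[cA tA]; apply: eclosed_order_family.
apply: ler_sum => A _; rewrite /u'.
have [->|/ucl cA] := eqVneq (u A) 0; first by rewrite !mul0r.
have [tA|/(eclosed_notop cA)->] := boolP (top \in A); last first.
  by rewrite mulr0 mul0r G0 mulr0.
rewrite mulr1 ler_wpM2l // G_top //; apply: hf; exact: eclosed_order_family.
Qed.

Let Fbar0 : 0 <= Fbar 0.
Proof.
rewrite -indic0 Fbar_indic /set_extension eclosure0 setDv cards0 mulr0 addr0.
by rewrite G0.
Qed.

Lemma extension_sublinear_envelope :
  is_sublinear_envelope (cube (1 + n)) Fbar (cube_sconv Fbar).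
Proof. exact: cube_sconvP. Qed.

Lemma extension_convex_envelope :
  is_convex_envelope (order_family D) f (fun x => cube_sconv Fbar (tx 1 x)).
Proof.
have [[[pZ pD] pF] _] := extension_sublinear_envelope.
split; last by move=> h ch x; apply: convex_minorant_le.
split; last first.
  move=> x Xx; rewrite -Fbar_lifted //; apply: pF.
  by apply/cube_tx; split; [right|case: Xx].
apply/convex_functionP => t x y /andP[t0 t1] Xx Xy; rewrite tx_comb.
have s0 : 0 <= 1 - t by rewrite subr_ge0.
have tx0 z : convex_hull (order_family D) z ->
    conic_hull (cube (1 + n)) (tx 1 z : 'rV[R]__).
  by move=> Xz; apply/conic_hull_cubeP; apply: convex_hull_tx1_ge0.
have txZ0 r z : 0 <= r -> convex_hull (order_family D) z ->
    conic_hull (cube (1 + n)) (r *: tx 1 z : 'rV[R]__).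
  move=> r0 Xz; apply/conic_hull_cubeP => i; rewrite mxE mulr_ge0 //.
  exact: convex_hull_tx1_ge0.
apply: le_trans (pD _ _ (txZ0 _ _ t0 Xx) (txZ0 _ _ s0 Xy)) _.
by rewrite !pZ //; apply: tx0.
Qed.

End Envelope.
End Bridge.

Theorem theorem2 (R : realType) (n K : nat) (D : rel 'I_n)
    (Drefl : reflexive D) (Danti : antisymmetric D) (Dtrans : transitive D)
    (f : 'rV[R]_n -> R) (fk : 'I_K.+1 -> 'rV[R]_n -> R)
    (f_disj : disjunctive_submodular (order_family D) f)
    (fk_submod : forall k, submodular_on (order_family D) (fk k))
    (f_min : forall x, order_family D x -> f x = min_fun fk x)
    (FL FU : R)
    (F_bounds : forall k z, lifted_family (order_family D) z ->
       FL <= lift_fun (fk k) z <= FU) :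
  let C := n.+1%:R ^+ 2 * (FU - FL) in
  let Fbar := fun k => extension D C (fk k) in
  (forall k, submodular_on (cube (1 + n)) (Fbar k)) /\
  exists g p,
    [/\ is_convex_envelope (order_family D) f g,
        is_sublinear_envelope (cube (1 + n)) (min_fun Fbar) p &
        forall x, convex_hull (order_family D) x -> g x = p (tx 1 x)].
Proof.
move=> C Fbar.
have FUL : 0 <= FU - FL.
  have /andP[] : FL <= lift_fun (fk ord0) (tx 0 0) <= FU by apply: F_bounds; left.
  lra.
have n1 : 1 <= n.+1%:R :> R by rewrite ler1n.
have leC : n.+1%:R * (FU - FL) <= C.
  rewrite /C ler_wpM2r // expr2 ler_peMr //.
have leC1 : FU - FL <= C by apply: le_trans leC; rewrite ler_peMl.
split=> [k|].
  by apply: extension_submod leC1 => //; apply: F_bounds.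
exists (fun x => cube_sconv (min_fun Fbar) (tx 1 x)), (cube_sconv (min_fun Fbar)).
split=> //; first exact: extension_convex_envelope leC.
exact: extension_sublinear_envelope.
Qed.
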